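(* Let $n\ge 3$. For the Grassmannian ${\rm Gr}(3,n)$, the block diagonal matching field polytopes $P_{\mathcal{B}_0}$ and $P_{\mathcal{B}_1}$ can be obtained from one another by a sequence of combinatorial mutations.
   Context: For $k=3$: for each $3$-subset $I=\{i_1<i_2<i_3\}$ of $[n]$ a matching field assigns $\sigma=\Lambda(I)\in S_3$; its polytope $P_\Lambda\subset\mathbb{R}^{3\times n}$ is the convex hull of the vectors $\sum_{r=1}^3 e_{\sigma(r),i_r}$ ($e_{i,j}$ the standard basis matrices). For $0\le\ell\le n$, the block diagonal matching field $\mathcal{B}_\ell$ has $\mathcal{B}_\ell(I)=\mathrm{id}$ if $|I\cap\{1,\dots,\ell\}|\ne1$ and $(12)$ otherwise. Combinatorial mutation: with $N\cong\mathbb{Z}^d$, $M$ its dual, $w\in M$ primitive and $F\subset w^\perp\subset N_\mathbb{R}$ a lattice polytope, the tropical map is $\varphi_{w,F}(u)=u-(\min_{f\in F}\langle f,u\rangle)w$; if $P\subset M_\mathbb{R}$ is a lattice polytope containing the origin and $\varphi_{w,F}(P)$ is convex, it is a combinatorial mutation of $P$. A sequence of combinatorial mutations is a finite chain of polytopes in which consecutive polytopes are related, after identification via lattice-preserving affine isomorphisms (unimodular equivalences) of the lattices they span, either by a unimodular equivalence or by a combinatorial mutation. *)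

(* Defs.v *)
From HB Require Import structures.
From mathcomp Require Import all_boot all_order all_algebra fingroup perm.
From mathcomp Require Import reals.
Set Implicit Arguments.
Unset Strict Implicit.
Unset Printing Implicit Defensive.
Import Order.TTheory GRing.Theory Num.Theory.
Local Open Scope ring_scope.

(* A lattice polytope in R^d, given as the convex hull of a finite list of
   lattice points of Z^d. *)
Record LP := mkLP { lp_dim : nat; lp_pts : seq 'rV[int]_lp_dim }.

Section Geometry.
Variable R : realType.

Definition intv (d : nat) (v : 'rV[int]_d) : 'rV[R]_d := map_mx (fun z : int => z%:~R) v.

Definition dotR (d : nat) (x y : 'rV[R]_d) : R := \sum_(i < d) x 0 i * y 0 i.

Definition in_conv (d : nat) (V : seq 'rV[int]_d) (x : 'rV[R]_d) : Prop :=
  exists lam : 'I_(size V) -> R,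
    [/\ forall i, 0 <= lam i, \sum_i lam i = 1 &
        x = \sum_i lam i *: intv (nth 0 V i)].

Definition in_aff (d : nat) (V : seq 'rV[int]_d) (x : 'rV[R]_d) : Prop :=
  exists lam : 'I_(size V) -> R,
    \sum_i lam i = 1 /\ x = \sum_i lam i *: intv (nth 0 V i).

Definition unimod_equiv (P Q : LP) : Prop :=
  exists (A : 'M[R]_(lp_dim P, lp_dim Q)) (b : 'rV[R]_(lp_dim Q)),
    let f := fun x => x *m A + b in
    [/\ forall x, in_aff (lp_pts P) x -> in_aff (lp_pts Q) (f x),
        forall x y, in_aff (lp_pts P) x -> in_aff (lp_pts P) y -> f x = f y -> x = y,
        forall y, in_aff (lp_pts Q) y -> exists2 x, in_aff (lp_pts P) x & f x = y,
        (forall z, in_aff (lp_pts P) (intv z) -> exists z', f (intv z) = intv z') /\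
        (forall z', in_aff (lp_pts Q) (intv z') ->
                   exists2 z, in_aff (lp_pts P) (intv z) & f (intv z) = intv z') &
        (forall x, in_conv (lp_pts P) x -> in_conv (lp_pts Q) (f x)) /\
        (forall y, in_conv (lp_pts Q) y -> exists2 x, in_conv (lp_pts P) x & f x = y)].

Definition primitive (d : nat) (w : 'rV[int]_d) : Prop :=
  w != 0 /\ forall (k : int) (v : 'rV[int]_d), w = k *: v -> k = 1 \/ k = -1.

(* tropical map phi_{w,F}(u) = u - (min_{f in F} <f,u>) w, where the
   lattice polytope F = conv (f0 :: Fs); the minimum of the linear
   function <.,u> over F is attained at one of the points f0 :: Fs. *)
Definition trop_map (d : nat) (w : 'rV[int]_d) (f0 : 'rV[int]_d)
  (Fs : seq 'rV[int]_d) (u : 'rV[R]_d) : 'rV[R]_d :=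
  u - (\big[Num.min/dotR (intv f0) u]_(f <- Fs) dotR (intv f) u) *: intv w.

Definition comb_mutation (d : nat) (P Q : seq 'rV[int]_d) : Prop :=
  exists (w : 'rV[int]_d) (f0 : 'rV[int]_d) (Fs : seq 'rV[int]_d),
    [/\ primitive w,
        forall f, f \in f0 :: Fs -> \sum_(i < d) f 0 i * w 0 i = 0,
        in_conv P 0,
        (forall y1 y2 (t : R),
            (exists2 x, in_conv P x & trop_map w f0 Fs x = y1) ->
            (exists2 x, in_conv P x & trop_map w f0 Fs x = y2) ->
            0 <= t <= 1 ->
            exists2 x, in_conv P x & trop_map w f0 Fs x = t *: y1 + (1 - t) *: y2) &
        forall y, (exists2 x, in_conv P x & trop_map w f0 Fs x = y) <-> in_conv Q y].

Definition mutation_step (P Q : LP) : Prop :=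
  unimod_equiv P Q \/
  exists (d : nat) (P' Q' : seq 'rV[int]_d),
    [/\ unimod_equiv P (mkLP P'), unimod_equiv Q (mkLP Q') &
        comb_mutation P' Q' \/ comb_mutation Q' P'].

Definition mutation_sequence (P Q : LP) : Prop :=
  exists (k : nat) (C : nat -> LP),
    [/\ C 0%N = P, C k = Q & forall i, (i < k)%N -> mutation_step (C i) (C i.+1)].

End Geometry.

(* a matching field assigns to each triple i1 < i2 < i3 of [n] (0-based
   indices a < b < c : 'I_n) a permutation in S_3; values on other triples
   are irrelevant. *)
Definition matching_field (n : nat) := 'I_n -> 'I_n -> 'I_n -> 'S_3.

Definition mf_vertex (n : nat) (L : matching_field n) (a b c : 'I_n) : 'M[int]_(3, n) :=
  \sum_(r < 3) delta_mx (L a b c r) (tnth [tuple a; b; c] r).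

Definition is_triple (n : nat) (t : 'I_n * 'I_n * 'I_n) : bool :=
  (t.1.1 < t.1.2)%N && (t.1.2 < t.2)%N.

Definition mf_polytope (n : nat) (L : matching_field n) : LP :=
  @mkLP (3 * n)
    [seq mxvec (mf_vertex L t.1.1 t.1.2 t.2)
       | t <- filter (@is_triple n) (enum {: 'I_n * 'I_n * 'I_n})].

(* block diagonal matching field B_l: identity if |I ∩ {1..l}| <> 1, and the
   transposition (12) otherwise (0-based: {1..l} = {i | i < l}, (12) swaps
   rows 0 and 1). *)
Definition block_diag (n l : nat) : matching_field n :=
  fun a b c =>
    if count (fun i : 'I_n => (i < l)%N) [:: a; b; c] != 1%N then 1%g
    else tperm (ord0 : 'I_3) (Ordinal (isT : (1 < 3)%N)).
Arguments block_diag : clear implicits.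
Arguments mutation_sequence : clear implicits.

(* Main.v *)
(* Interpolate between the two fields by the fields L_k, 1 <= k <= n - 1, which swap the
   first two entries of a triple {0, b, c} (0-based) exactly when b < k.  Passing from L_k
   to L_{k+1} moves only the vertices of the triples {0, k, c}, all by the same vector
   w = e_{2,0} + e_{1,k} - e_{1,0} - e_{2,k}.  There is a linear form f with f(w) = 0 equal
   to -1 on the moved vertices and to 0 or 1 on the others, such that the sum of a vertex
   of height -1 and one of height 1 is also the sum of two vertices of height 0, before
   and after the move.  Hence both polytopes meet the hyperplane f = 0 in the hull of
   their common vertices of height 0, and the tropical map of w and conv(0, f) carries
   one onto the other, after translating a vertex of height 0 to the origin.  For n = 3
   there is no such vertex, but the polytopes are single points. *)
Require Import Defs.
From HB Require Import structures.
From mathcomp Require Import all_boot all_order all_algebra fingroup perm.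
From mathcomp Require Import reals.
From mathcomp Require Import ring zify.
Set Implicit Arguments.
Unset Strict Implicit.
Unset Printing Implicit Defensive.
Import Order.TTheory GRing.Theory Num.Theory.
Local Open Scope ring_scope.

(** * Convex and affine hulls as weighted combinations *)

(* [wcomb K P m x]: x is a linear combination of points of P, with coefficients
   in K and of total weight m.  Convex and affine hulls are the case m = 1. *)
Inductive wcomb (R : realType) (d : nat) (K : R -> Prop) (P : 'rV[R]_d -> Prop) :
  R -> 'rV[R]_d -> Prop :=
| wcomb0 : wcomb K P 0 0
| wcombD m x m' x' : wcomb K P m x -> wcomb K P m' x' -> wcomb K P (m + m') (x + x')
| wcomb_atom a x : K a -> P x -> wcomb K P a (a *: x).

Definition nneg (R : realType) (a : R) : Prop := 0 <= a.
Definition anyc (R : realType) (a : R) : Prop := True.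

Definition lpt (R : realType) (d : nat) (V : seq 'rV[int]_d) (x : 'rV[R]_d) : Prop :=
  exists2 v, v \in V & x = intv R v.

(** The map also sees the weight, so that a translation, written [y + m *: t], becomes additive and
    homogeneous and is handled like a linear map. *)
Lemma wcomb_map (R : realType) (d : nat) (K : R -> Prop) (P Q : 'rV[R]_d -> Prop)
    (T : R -> 'rV[R]_d -> 'rV[R]_d) :
  (forall m x m' x', T (m + m') (x + x') = T m x + T m' x') ->
  (forall a x, T a (a *: x) = a *: T 1 x) ->
  (forall x, P x -> Q (T 1 x)) ->
  forall m x, wcomb K P m x -> wcomb K Q m (T m x).
Proof.
move=> TD TZ PQ m x; elim=> {m x} [|m x m' x' _ IH _ IH'|a x Ka Px].
- have -> : T 0 0 = 0 by rewrite -[X in T 0 X](scale0r 0) TZ scale0r.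
  exact: wcomb0.
- by rewrite TD; apply: wcombD.
- by rewrite TZ; apply: wcomb_atom => //; apply: PQ.
Qed.

Lemma wcomb_sub (R : realType) (d : nat) (K : R -> Prop) (P Q : 'rV[R]_d -> Prop) m x :
  (forall y, P y -> Q y) -> wcomb K P m x -> wcomb K Q m x.
Proof. by move=> PQ; apply: (wcomb_map (T := fun _ y => y)). Qed.

Lemma wcomb_scale (R : realType) (d : nat) (P : 'rV[R]_d -> Prop) (c m : R) x :
  0 <= c -> wcomb (@nneg R) P m x -> wcomb (@nneg R) P (c * m) (c *: x).
Proof.
move=> c0; elim=> {m x} [|m x m' x' _ IH _ IH'|a x Ka Px].
- by rewrite mulr0 scaler0; apply: wcomb0.
- by rewrite mulrDr scalerDr; apply: wcombD.
- by rewrite scalerA; apply: wcomb_atom => //; apply: mulr_ge0.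
Qed.

Lemma wcomb_ge0 (R : realType) (d : nat) (P : 'rV[R]_d -> Prop) (m : R) x :
  wcomb (@nneg R) P m x -> 0 <= m.
Proof. by elim=> {m x} // m x m' x' _ ? _ ?; apply: addr_ge0. Qed.

Lemma wcomb_weight0 (R : realType) (d : nat) (P : 'rV[R]_d -> Prop) (m : R) x :
  wcomb (@nneg R) P m x -> m = 0 -> x = 0.
Proof.
elim=> {m x} [//|m x m' x' c IH c' IH'|a x _ _ ->]; last by rewrite scale0r.
move/eqP; rewrite paddr_eq0 ?(wcomb_ge0 c) ?(wcomb_ge0 c') // => /andP[/eqP m0 /eqP m'0].
by rewrite IH // IH' // addr0.
Qed.

Lemma wcomb_seqP (R : realType) (d : nat) (K : R -> Prop) (V : seq 'rV[int]_d) m x :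
  K 0 -> (forall a b, K a -> K b -> K (a + b)) ->
  wcomb K (lpt V) m x <->
  exists lam : 'I_(size V) -> R, [/\ forall i, K (lam i), \sum_i lam i = m &
     x = \sum_i lam i *: intv R (nth 0 V i)].
Proof.
move=> K0 KD; split.
  elim=> {m x} [|m x m' x' _ [l [Kl <- ->]] _ [l' [Kl' <- ->]]|a x Ka [v vV ->]].
  - exists (fun=> 0); split=> //; first by rewrite big1.
    by rewrite big1 // => i _; rewrite scale0r.
  - exists (fun i => l i + l' i); split=> [i||]; first exact: KD.
      by rewrite big_split.
    by rewrite -big_split; apply: eq_bigr => i _; rewrite scalerDl.
  (* Points may repeat in [V]; the whole coefficient goes to the first occurrence. *)
  - have iV : (index v V < size V)%N by rewrite index_mem.
    pose i0 := Ordinal iV.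
    exists (fun i => if i == i0 then a else 0); split.
    + by move=> i; case: eqP.
    + by rewrite -big_mkcond big_pred1_eq.
    + rewrite (bigD1 i0) //= eqxx nth_index // big1 ?addr0 // => i /negPf ->.
      by rewrite scale0r.
move=> [l [Kl <- ->]].
apply: (big_ind2 (fun y m => wcomb K (lpt V) m y)) => //.
- exact: wcomb0.
- by move=> *; apply: wcombD.
- by move=> i _; apply: wcomb_atom => //; exists (nth 0 V i) => //; apply: mem_nth.
Qed.

Lemma in_convP (R : realType) (d : nat) (V : seq 'rV[int]_d) (x : 'rV[R]_d) :
  in_conv V x <-> wcomb (@nneg R) (lpt V) 1 x.
Proof. by rewrite wcomb_seqP //; [exact: lexx | move=> *; apply: addr_ge0]. Qed.

Lemma in_affP (R : realType) (d : nat) (V : seq 'rV[int]_d) (x : 'rV[R]_d) :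
  in_aff V x <-> wcomb (@anyc R) (lpt V) 1 x.
Proof.
rewrite wcomb_seqP //; split; first by move=> [l [? ?]]; exists l.
by move=> [l [_ ? ?]]; exists l.
Qed.

(** * Lattice translations *)

Lemma intvD (R : realType) (d : nat) (u v : 'rV[int]_d) :
  intv R (u + v) = intv R u + intv R v.
Proof. by apply/rowP => i; rewrite !mxE intrD. Qed.

Lemma intvN (R : realType) (d : nat) (u : 'rV[int]_d) : intv R (- u) = - intv R u.
Proof. by apply/rowP => i; rewrite !mxE intrN. Qed.

Lemma wcomb_translate (R : realType) (d : nat) (K : R -> Prop) (V : seq 'rV[int]_d)
    (t : 'rV[int]_d) x :
  wcomb K (lpt [seq v + t | v <- V]) 1 (x + intv R t) <-> wcomb K (lpt V) 1 x.
Proof.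
split=> H.
  have -> : x = (x + intv R t) - 1 *: intv R t by rewrite scale1r addrK.
  apply: (wcomb_map (T := fun m y => y - m *: intv R t)) H.
  - by move=> m {}x m' x'; rewrite scalerDl opprD addrACA.
  - by move=> a {}x; rewrite scale1r scalerBr.
  - move=> _ [_ /mapP[v vV ->] ->]; exists v => //.
    by rewrite intvD scale1r addrK.
rewrite -[intv R t]scale1r.
apply: (wcomb_map (T := fun m y => y + m *: intv R t)) H.
- by move=> m {}x m' x'; rewrite scalerDl addrACA.
- by move=> a {}x; rewrite scale1r scalerDr.
- move=> _ [v vV ->]; exists (v + t); last by rewrite intvD scale1r.
  exact: map_f.
Qed.

Lemma translate_equiv (R : realType) (d : nat) (V : seq 'rV[int]_d) (t : 'rV[int]_d) :
  unimod_equiv R (mkLP V) (mkLP [seq v + t | v <- V]).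
Proof.
pose V' := [seq v + t | v <- V].
have aff x : in_aff V' (x + intv R t) <-> in_aff V x.
  by rewrite !in_affP wcomb_translate.
have conv x : in_conv V' (x + intv R t) <-> in_conv V x.
  by rewrite !in_convP wcomb_translate.
exists 1%:M, (intv R t) => /=; split.
- by move=> x; rewrite mulmx1 aff.
- by move=> x y _ _; rewrite !mulmx1 => /addIr.
- by move=> y Hy; exists (y - intv R t); rewrite ?mulmx1 ?subrK // -aff subrK.
- split=> [z _|z Hz]; first by exists (z + t); rewrite mulmx1 intvD.
  by exists (z - t); rewrite ?mulmx1 -?intvD ?subrK // -aff -intvD subrK.
- split=> [x|y Hy]; first by rewrite mulmx1 conv.
  by exists (y - intv R t); rewrite ?mulmx1 ?subrK // -conv subrK.
Qed.

(** * Moving weight onto a hyperplane *)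

Lemma wcomb_fun_ge0 (R : realType) (d : nat) (P : 'rV[R]_d -> Prop) (g : 'rV[R]_d -> R) m x :
  (forall x y, g (x + y) = g x + g y) -> (forall a x, g (a *: x) = a * g x) ->
  (forall y, P y -> 0 <= g y) -> wcomb (@nneg R) P m x -> 0 <= g x.
Proof.
move=> gD gZ gP; elim=> {m x} [|m x m' x' _ ? _ ?|a x a0 Px].
- by have := gZ 0 0; rewrite scale0r mul0r => ->.
- by rewrite gD addr_ge0.
- by rewrite gZ mulr_ge0 // gP.
Qed.

(* Averaging over pairs with product weights; the coefficients b and a, instead
   of b / (a + b) and a / (a + b), make the statement bilinear, so that induction on both
   combinations applies. *)
Lemma wcomb_pair (R : realType) (d : nat) (N Z P : 'rV[R]_d -> Prop) :
  (forall u v, N u -> P v -> exists p q, [/\ Z p, Z q & u + v = p + q]) ->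
  forall a y b z, wcomb (@nneg R) N a y -> wcomb (@nneg R) P b z ->
  wcomb (@nneg R) Z (2 * (a * b)) (b *: y + a *: z).
Proof.
move=> NZP a y b z Ny; elim=> {b z} [|b z b' z' _ IH _ IH'|b v b0 Pv].
- by rewrite !mulr0 scale0r scaler0 addr0; apply: wcomb0.
- by rewrite scalerDl scalerDr addrACA !mulrDr; apply: wcombD.
elim: Ny => {a y} [|a y a' y' _ IH _ IH'|a u a0 Nu].
- by rewrite mul0r mulr0 scaler0 scale0r addr0; apply: wcomb0.
- by rewrite scalerDl scalerDr addrACA [(a + a') * b]mulrDl mulrDr; apply: wcombD.
have [p [q [Zp Zq uv]]] := NZP u v Nu Pv.
have -> : b *: (a *: u) + a *: (b *: v) = (a * b) *: p + (a * b) *: q.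
  by rewrite !scalerA [b * a]mulrC -!scalerDr uv.
rewrite [2]mulr2n mulrDl mul1r.
by apply: wcombD; apply: wcomb_atom => //; apply: mulr_ge0.
Qed.

(** The lighter weight [a] is paired in full with an equal weight on [P], which puts [2 * a] on [Z];
    [a <= b] makes the rest [b - a] on [P] nonnegative. *)
Lemma wcomb_merge (R : realType) (d : nat) (N Z P : 'rV[R]_d -> Prop) a y b z :
  (forall u v, N u -> P v -> exists p q, [/\ Z p, Z q & u + v = p + q]) ->
  wcomb (@nneg R) N a y -> wcomb (@nneg R) P b z -> a <= b ->
  wcomb (@nneg R) (fun x => Z x \/ P x) (a + b) (y + z).
Proof.
move=> NZP Ny Pz ab.
have a0 := wcomb_ge0 Ny; have b0 := wcomb_ge0 Pz.
have [b_eq0|b_neq0] := eqVneq b 0.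
  have aE : a = 0 by apply/eqP; rewrite eq_le a0 -b_eq0 ab.
  by rewrite (wcomb_weight0 Ny aE) (wcomb_weight0 Pz b_eq0) aE b_eq0 !addr0; apply: wcomb0.
have -> : a + b = b^-1 * (2 * (a * b)) + (1 - b^-1 * a) * b by field.
have -> : y + z = b^-1 *: (b *: y + a *: z) + (1 - b^-1 * a) *: z.
  by rewrite scalerDr !scalerA mulVf // scale1r -addrA -scalerDl [_ * a + _]addrC subrK scale1r.
apply: wcombD.
  apply: wcomb_scale; first by rewrite invr_ge0.
  by apply: wcomb_sub (wcomb_pair NZP Ny Pz) => ?; left.
apply: wcomb_scale; last by apply: wcomb_sub Pz => ?; right.
by rewrite subr_ge0 mulrC ler_pdivrMr ?mul1r // lt_neqAle eq_sym b_neq0.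
Qed.

(* A combination of points on both sides of the hyperplane spanned by Z can be rewritten
   with points on one side only, where the tropical map is linear. *)
Lemma wcomb_sides (R : realType) (d : nat) (N Z P : 'rV[R]_d -> Prop) m x :
  (forall u v, N u -> P v -> exists p q, [/\ Z p, Z q & u + v = p + q]) ->
  wcomb (@nneg R) (fun y => N y \/ (Z y \/ P y)) m x ->
  wcomb (@nneg R) (fun y => Z y \/ P y) m x \/ wcomb (@nneg R) (fun y => Z y \/ N y) m x.
Proof.
move=> NZP H.
have PZN u v : P u -> N v -> exists p q, [/\ Z p, Z q & u + v = p + q].
  by move=> Pu Nv; have [p [q ?]] := NZP v u Nv Pu; exists p, q; rewrite addrC.
(* Sort the combination by class; comparing [a] with [b] then decides which side survives. *)
have [a [y [b [z [c [t [Ny Pz Zt -> ->]]]]]]] : exists a y b z c t,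
    [/\ wcomb (@nneg R) N a y, wcomb (@nneg R) P b z, wcomb (@nneg R) Z c t,
        m = a + b + c & x = y + z + t].
  have W0 Y : wcomb (@nneg R) Y 0 0 by apply: wcomb0.
  elim: H => {m x} [|m x m' x' _ + _|a x a0 [Nx|[Zx|Px]]].
  - by exists 0, 0, 0, 0, 0, 0; rewrite !addr0.
  - move=> [a [y [b [z [c [t [? ? ? -> ->]]]]]]] [a' [y' [b' [z' [c' [t' [? ? ? -> ->]]]]]]].
    exists (a + a'), (y + y'), (b + b'), (z + z'), (c + c'), (t + t').
    split; [exact: wcombD | exact: wcombD | exact: wcombD | |].
    + by rewrite addrACA [a + b + _]addrACA.
    + by rewrite addrACA [y + z + _]addrACA.
  - by exists a, (a *: x), 0, 0, 0, 0; rewrite !addr0; split=> //; apply: wcomb_atom.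
  - by exists 0, 0, 0, 0, a, (a *: x); rewrite !add0r; split=> //; apply: wcomb_atom.
  - by exists 0, 0, a, (a *: x), 0, 0; rewrite !add0r !addr0; split=> //; apply: wcomb_atom.
have ZZ Y : wcomb (@nneg R) (fun x => Z x \/ Y x) c t by apply: wcomb_sub Zt => ?; left.
have [ab|/ltW ba] := leP a b; [left|right]; apply: wcombD (ZZ _).
  exact: wcomb_merge NZP Ny Pz ab.
by rewrite [a + b]addrC [y + z]addrC; apply: wcomb_merge PZN Pz Ny ba.
Qed.

(** * Heights, shears and the tropical map *)

Definition height (d : nat) (f v : 'rV[int]_d) : int := \sum_i f 0 i * v 0 i.

Lemma heightD (d : nat) (f u v : 'rV[int]_d) : height f (u + v) = height f u + height f v.
Proof. by rewrite -big_split; apply: eq_bigr => i _; rewrite mxE mulrDr. Qed.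

Lemma heightN (d : nat) (f v : 'rV[int]_d) : height f (- v) = - height f v.
Proof. by rewrite -sumrN; apply: eq_bigr => i _; rewrite mxE mulrN. Qed.

Lemma dotR_intv (R : realType) (d : nat) (f v : 'rV[int]_d) :
  dotR (intv R f) (intv R v) = (height f v)%:~R.
Proof.
by rewrite /height rmorph_sum; apply: eq_bigr => i _; rewrite !mxE /= intrM.
Qed.

Lemma dotRD (R : realType) (d : nat) (f x y : 'rV[R]_d) :
  dotR f (x + y) = dotR f x + dotR f y.
Proof. by rewrite -big_split; apply: eq_bigr => i _; rewrite mxE mulrDr. Qed.

Lemma dotRZ (R : realType) (d : nat) (f : 'rV[R]_d) a x : dotR f (a *: x) = a * dotR f x.
Proof. by rewrite /dotR mulr_sumr; apply: eq_bigr => i _; rewrite mxE mulrCA. Qed.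

Lemma trop_segment (R : realType) (d : nat) (w f : 'rV[int]_d) (x : 'rV[R]_d) :
  trop_map w 0 [:: f] x = x - Num.min (dotR (intv R f) x) 0 *: intv R w.
Proof.
rewrite /trop_map big_cons big_nil; congr (_ - Num.min _ _ *: _).
by rewrite /dotR big1 // => i _; rewrite !mxE mul0r.
Qed.

(* Second clause: a segment joining points at heights -1 and 1 has the same midpoint as
   a segment joining two points at height 0, so that bending along the hyperplane of
   height 0 maps the convex hull of V into that of W. *)
Definition shears (d : nat) (w f : 'rV[int]_d) (V W : seq 'rV[int]_d) : Prop :=
  (forall v, v \in V -> (height f v = 0 \/ height f v = 1) /\ v \in W
                        \/ height f v = -1 /\ v + w \in W) /\
  (forall u v, u \in V -> v \in V -> height f u = -1 -> height f v = 1 ->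
   exists p q, [/\ p \in V, q \in V, height f p = 0, height f q = 0 & u + v = p + q]).

(** By [wcomb_sides] all generators can be taken on one side, where the tropical map is linear: the
    identity on heights 0 and 1, or the map fixing height 0 and adding [w] at height -1. *)
Lemma shears_trop (R : realType) (d : nat) (w f : 'rV[int]_d) V W (x : 'rV[R]_d) :
  shears w f V W -> in_conv V x -> in_conv W (trop_map w 0 [:: f] x).
Proof.
move=> [VW exch]; rewrite !in_convP trop_segment => Vx.
pose L h y := exists2 v, v \in V /\ height f v = h & y = intv R v.
have LVW (h : int) y : L h y -> dotR (intv R f) y = h%:~R /\
    lpt W (if h == -1 then y + intv R w else y).
  move=> [v [vV hv] ->]; rewrite dotR_intv hv; split=> //.
  case: (VW v vV) => [[[]]|[]]; rewrite hv => -> vW /=.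
  - by exists v.
  - by exists v.
  - by exists (v + w); rewrite ?intvD.
have : wcomb (@nneg R) (fun y => L (-1) y \/ (L 0 y \/ L 1 y)) 1 x.
  apply: wcomb_sub Vx => _ [v vV ->].
  case: (VW v vV) => [[[] h _]|[h _]].
  - by right; left; exists v.
  - by right; right; exists v.
  - by left; exists v.
case/wcomb_sides => [u v [u' [uV hu] ->] [v' [vV hv] ->]|side|side].
- have [p [q [pV qV hp hq e]]] := exch u' v' uV vV hu hv.
  by exists (intv R p), (intv R q); rewrite -!intvD e; split=> //; [exists p|exists q].
- have x0 : 0 <= dotR (intv R f) x.
    apply: wcomb_fun_ge0 side; [exact: dotRD | exact: dotRZ |].
    by move=> y [] /LVW [-> _]; rewrite ?ler01.
  rewrite (min_idPr x0) scale0r subr0.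
  by apply: wcomb_sub side => y [] /LVW [].
- have x0 : dotR (intv R f) x <= 0.
    rewrite -oppr_ge0; apply: wcomb_fun_ge0 (fun y => - dotR (intv R f) y) _ _ _ _ _ side.
    + by move=> y z; rewrite dotRD opprD.
    + by move=> a y; rewrite dotRZ mulrN.
    + by move=> y [] /LVW [-> _]; rewrite ?oppr0 // opprK ler01.
  rewrite (min_idPl x0).
  apply: (wcomb_map (T := fun _ y => y - dotR (intv R f) y *: intv R w)) side.
  + by move=> _ y _ z; rewrite dotRD scalerDl opprD addrACA.
  + by move=> a y; rewrite dotRZ -scalerA -scalerBr.
  + move=> y [] /LVW [-> /=]; first by rewrite scale0r subr0.
    by rewrite scaleN1r opprK.
Qed.

(** Since [f] vanishes on [w], bending along [- w] is undone by bending along [w]. The two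
    inclusions from [shears_trop] thus give equality, and the image is convex because the hull of
    [W] is. *)
Lemma shears_mutation (R : realType) (d : nat) (w f : 'rV[int]_d) V W :
  primitive w -> height f w = 0 -> 0 \in V -> shears w f V W -> shears (- w) f W V ->
  comb_mutation R V W.
Proof.
move=> w_prim fw0 V0 VW WV.
have tropK (y : 'rV[R]_d) :
    trop_map w 0 [:: f] (trop_map (- w) 0 [:: f] y) = y.
  rewrite !trop_segment intvN scalerN opprK dotRD dotRZ dotR_intv fw0 mulr0 addr0.
  exact: addrK.
have img (y : 'rV[R]_d) :
    (exists2 x, in_conv V x & trop_map w 0 [:: f] x = y) <-> in_conv W y.
  split=> [[x Vx <-]|Wy]; first exact: shears_trop VW Vx.
  by exists (trop_map (- w) 0 [:: f] y); [apply: shears_trop WV Wy|].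
exists w, 0, [:: f]; split=> //.
- move=> g; rewrite !inE => /orP[] /eqP -> //.
  by rewrite big1 // => i _; rewrite mxE mul0r.
- apply/in_convP; rewrite -[X in wcomb _ _ _ X](scaler0 _ 1).
  apply: wcomb_atom; first exact: ler01.
  by exists 0 => //; apply/rowP => i; rewrite !mxE.
- move=> y1 y2 t /img /in_convP W1 /img /in_convP W2 /andP[t0 t1].
  apply/img/in_convP.
  rewrite -[X in wcomb _ _ X](subrK t) addrC -{1}[t]mulr1 -[X in _ + X]mulr1.
  by apply: wcombD; apply: wcomb_scale; rewrite ?subr_ge0.
Qed.

Lemma shears_translate (d : nat) (w f t : 'rV[int]_d) V W :
  height f t = 0 -> shears w f V W ->
  shears w f [seq v + t | v <- V] [seq v + t | v <- W].
Proof.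
move=> ft [VW exch]; split.
  move=> _ /mapP[v vV ->]; rewrite heightD ft addr0 addrAC.
  by rewrite !(mem_map (addIr t)); apply: VW.
move=> _ _ /mapP[u uV ->] /mapP[v vV ->]; rewrite !heightD ft !addr0 => hu hv.
have [p [q [pV qV hp hq uv]]] := exch u v uV vV hu hv.
exists (p + t), (q + t); rewrite !heightD ft !addr0; split=> //.
- exact: map_f.
- exact: map_f.
- by rewrite addrACA uv addrACA.
Qed.

(** A mutation needs the origin in the polytope. Subtracting a vertex of height 0 puts it there
    without changing any height. *)
Lemma shears_step (R : realType) (d : nat) (w f v0 : 'rV[int]_d) V W :
  primitive w -> height f w = 0 -> v0 \in V -> height f v0 = 0 ->
  shears w f V W -> shears (- w) f W V ->
  mutation_step R (mkLP V) (mkLP W).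
Proof.
move=> w_prim fw V0 fv0 VW WV; right.
have ft : height f (- v0) = 0 by rewrite heightN fv0 oppr0.
exists d, [seq v - v0 | v <- V], [seq v - v0 | v <- W].
split; try exact: translate_equiv.
left; apply: (shears_mutation R w_prim fw) => //.
- by apply/mapP; exists v0; rewrite ?subrr.
- exact: shears_translate.
- exact: shears_translate.
Qed.

(** * Vertices of the interpolating fields *)

Definition unit_vec (n : nat) (r : 'I_3) (i : 'I_n) : 'rV[int]_(3 * n) := mxvec (delta_mx r i).

(** Arguments follow the rows, not the order of the triple, so a swapped triple just has its first
    two arguments exchanged. *)
Definition vertex (n : nat) (i j c : 'I_n) : 'rV[int]_(3 * n) :=
  unit_vec 0 i + unit_vec 1 j + unit_vec 2%:R c.

Definition partial_swap (n k : nat) : matching_field n := fun a b c =>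
  if ((a : nat) == 0%N) && (b < k)%N then tperm (ord0 : 'I_3) (Ordinal (isT : (1 < 3)%N))
  else 1%g.

Lemma mf_vertex_id (n : nat) (L : matching_field n) (a b c : 'I_n) :
  L a b c = 1%g -> mxvec (mf_vertex L a b c) = vertex a b c.
Proof.
move=> Lid; rewrite /mf_vertex !big_ord_recl big_ord0 !Lid !perm1 addr0 !linearD /= addrA.
by congr (mxvec (delta_mx _ _) + mxvec (delta_mx _ _) + mxvec (delta_mx _ _)); apply: val_inj.
Qed.

Lemma mf_vertex_swap (n : nat) (L : matching_field n) (a b c : 'I_n) :
  L a b c = tperm (ord0 : 'I_3) (Ordinal (isT : (1 < 3)%N)) ->
  mxvec (mf_vertex L a b c) = vertex b a c.
Proof.
move=> Lab; rewrite /mf_vertex !big_ord_recl big_ord0 !Lab !addr0 !linearD /= addrA.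
have -> : lift ord0 ord0 = Ordinal (isT : (1 < 3)%N) by apply: val_inj.
rewrite tpermL tpermR tpermD // [X in X + _]addrC.
by congr (mxvec (delta_mx _ _) + mxvec (delta_mx _ _) + mxvec (delta_mx _ _)); apply: val_inj.
Qed.

Lemma eq_mf_polytope (n : nat) (L L' : matching_field n) :
  (forall a b c : 'I_n, (a < b < c)%N -> L a b c = L' a b c) ->
  mf_polytope L = mf_polytope L'.
Proof.
move=> LL'; rewrite /mf_polytope; congr mkLP; apply/eq_in_map => t.
by rewrite mem_filter => /andP[abc _]; rewrite /mf_vertex LL'.
Qed.

(** A swap for [k = 1] would need middle entry 0, which no increasing triple has. *)
Lemma block_diag0_swap (n : nat) :
  mf_polytope (block_diag n 0) = mf_polytope (partial_swap (n := n) 1).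
Proof.
apply: eq_mf_polytope => a b c /andP[ab bc]; rewrite /block_diag /partial_swap /= ltnS leqn0.
have -> : ((b : nat) == 0%N) = false by lia.
by rewrite andbF.
Qed.

(** The middle entry is at most [n - 2], so for [k = n - 1] every triple containing 0 is swapped. *)
Lemma block_diag1_swap (n : nat) :
  mf_polytope (block_diag n 1) = mf_polytope (partial_swap (n := n) n.-1).
Proof.
apply: eq_mf_polytope => a b c /andP[ab bc].
have bn : (b < n.-1)%N by have := ltn_ord c; lia.
rewrite /block_diag /partial_swap bn andbT /= !ltnS !leqn0.
have -> : ((b : nat) == 0%N) = false by lia.
have -> : ((c : nat) == 0%N) = false by lia.
by case: ((a : nat) == 0%N).
Qed.

Lemma vertex_partial_swap (n k : nat) (a b c : 'I_n) :
  mxvec (mf_vertex (partial_swap (n := n) k) a b c) =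
  if ((a : nat) == 0%N) && (b < k)%N then vertex b a c else vertex a b c.
Proof.
case: ifP => E; first by apply: mf_vertex_swap; rewrite /partial_swap E.
by apply: mf_vertex_id; rewrite /partial_swap E.
Qed.

Definition swap_pts (n k : nat) := lp_pts (mf_polytope (partial_swap (n := n) k)).

Lemma swap_ptsP (m k : nat) (v : 'rV[int]_(3 * m.+3)) :
  v \in swap_pts m.+3 k <->
  (exists b c : 'I_m.+3, [/\ (0 < b < k)%N, (b < c)%N & v = vertex b ord0 c]) \/
  (exists a b c : 'I_m.+3, [/\ (a < b < c)%N, (0 < a)%N || (k <= b)%N & v = vertex a b c]).
Proof.
split.
  move=> /mapP[[[a b] c]]; rewrite mem_filter => /andP[/andP[/= ab bc] _] ->.
  rewrite vertex_partial_swap; case: ifP => E.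
    left; exists b, c; have -> : a = ord0 by apply/ord_inj; case/andP: E => /eqP.
    by split=> //; lia.
  by right; exists a, b, c; split=> //; lia.
case=> [[b [c [bk bc ->]]]|[a [b [c [abc ak ->]]]]]; apply/mapP.
  exists (ord0, b, c); first by rewrite mem_filter mem_enum andbT /is_triple /=; lia.
  by rewrite vertex_partial_swap ifT //=; lia.
exists (a, b, c); first by rewrite mem_filter mem_enum andbT /is_triple /=; lia.
by rewrite vertex_partial_swap ifF //=; lia.
Qed.

(** * Shears between consecutive fields *)

(* On a vertex of the polytope this functional is -1 exactly at the triples {0, k, c}
   that change, 1 at the triples {a, b, c} with 0 < a < k < b, and 0 elsewhere. *)
Definition slope (n k : nat) : 'rV[int]_(3 * n) :=
  mxvec (\matrix_(r < 3, j < n)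
    [:: (nat_of_bool (0 < j < k)%N)%:Z; - (nat_of_bool (j <= k)%N)%:Z; 0]`_r).

Lemma height_vertex (n k : nat) (i j c : 'I_n) :
  height (slope n k) (vertex i j c) =
  (nat_of_bool (0 < i < k)%N)%:Z - (nat_of_bool (j <= k)%N)%:Z.
Proof.
have hu r (x : 'I_n) : height (slope n k) (unit_vec r x) = slope n k 0 (mxvec_index r x).
  rewrite /height /unit_vec mxvec_delta (bigD1 (mxvec_index r x)) //= mxE !eqxx mulr1.
  by rewrite big1 ?addr0 // => y /negPf; rewrite mxE eqxx /= => ->; rewrite mulr0.
by rewrite /vertex !heightD !hu !mxvecE !mxE /= addr0.
Qed.

(** The third argument [k] is arbitrary, as it cancels. *)
Definition shear_dir (m : nat) (k : 'I_m.+3) : 'rV[int]_(3 * m.+3) :=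
  vertex k ord0 k - vertex ord0 k k.

Lemma vertex_exchange (n : nat) (i j c i' j' c' : 'I_n) :
  vertex i j c + vertex i' j' c' = vertex i' j c + vertex i j' c'.
Proof. by apply/rowP => x; rewrite !mxE; ring. Qed.

Lemma vertex_shear (m : nat) (k c : 'I_m.+3) :
  vertex ord0 k c + shear_dir k = vertex k ord0 c.
Proof. by apply/rowP => x; rewrite !mxE; ring. Qed.

(** The coordinate in row 0, column [k] is 1, so every integer factor is a unit. *)
Lemma shear_dir_primitive (m : nat) (k : 'I_m.+3) : (0 < k)%N -> primitive (shear_dir k).
Proof.
move=> k0; have w1 : shear_dir k 0 (mxvec_index 0 k) = 1.
  by rewrite /shear_dir !mxE !mxvecE !mxE /= !eqxx /= -!(inj_eq val_inj) /= (gtn_eqF k0).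
split; first by apply/eqP => w0; move: w1; rewrite w0 mxE.
move=> x v wv; move: w1; rewrite wv mxE mulrC => /intUnitRing.unitzPl.
by rewrite qualifE => /orP[] /eqP ->; [left|right].
Qed.
Lemma shears_up (m : nat) (k : 'I_m.+3) : (0 < k)%N ->
  shears (shear_dir k) (slope m.+3 k) (swap_pts m.+3 k) (swap_pts m.+3 k.+1).
Proof.
move=> k0; split.
  move=> v /swap_ptsP [[b [c [bk bc ->]]]|[a [b [c [abc ak ->]]]]]; rewrite height_vertex.
    left; split; first by rewrite bk /=; left.
    by apply/swap_ptsP; left; exists b, c; split=> //; lia.
  have [ab0|ab0] := boolP (((a : nat) == 0%N) && ((b : nat) == k)).
    have {ab0} [a0 bk] : a = ord0 /\ b = k.
      by case/andP: ab0 => /eqP a0 /eqP bk; split; apply: ord_inj.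
    subst a b.
    right; split; first by rewrite ?leqnn /=; lia.
    rewrite vertex_shear; apply/swap_ptsP; left; exists k, c; split=> //; lia.
  left; split; first by rewrite ?leqnn /=; lia.
  by apply/swap_ptsP; right; exists a, b, c; split=> //; lia.
move=> u v /swap_ptsP [[b [c [bk bc ->]]]|[a [b [c [abc ak ->]]]]]; rewrite height_vertex.
  by lia.
move=> + hu; have a0 : a = ord0 by apply: ord_inj => /=; lia.
have {}hu : b = k by apply: ord_inj; lia.
subst a b.
move=> /swap_ptsP [[b' [c' [bk' bc' ->]]]|[a' [b' [c' [abc' ak' ->]]]]]; rewrite height_vertex.
  by lia.
move=> hv; rewrite vertex_exchange.
(* Here 0 < a' < k < b', so exchanging the row 0 entries gives the triples {a', k, c} and {0, b',
   c'}, both increasing and unswapped. *)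
exists (vertex a' k c), (vertex ord0 b' c'); rewrite !height_vertex /=; split=> //; try lia.
- by apply/swap_ptsP; right; exists a', k, c; split=> //; lia.
- by apply/swap_ptsP; right; exists ord0, b', c'; split=> //=; lia.
Qed.

Lemma shears_down (m : nat) (k : 'I_m.+3) : (0 < k)%N ->
  shears (- shear_dir k) (slope m.+3 k) (swap_pts m.+3 k.+1) (swap_pts m.+3 k).
Proof.
move=> k0; split.
  move=> v /swap_ptsP [[b [c [bk bc ->]]]|[a [b [c [abc ak ->]]]]]; rewrite height_vertex.
    have [bk'|bk'] := boolP ((b : nat) == k).
      have {}bk' : b = k by apply/ord_inj/eqP.
      subst b.
      right; split; first by rewrite /=; lia.
      rewrite -vertex_shear addrK; apply/swap_ptsP; right.
      by exists ord0, k, c; split=> //=; lia.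
    left; split; first by rewrite /=; lia.
    by apply/swap_ptsP; left; exists b, c; split=> //; lia.
  left; split; first by rewrite ?leqnn /=; lia.
  by apply/swap_ptsP; right; exists a, b, c; split=> //; lia.
move=> u v /swap_ptsP [[b [c [bk bc ->]]]|[a [b [c [abc ak ->]]]]]; rewrite height_vertex;
  last by lia.
move=> + hu; have {hu} bk' : b = k by apply: ord_inj; move: hu => /=; lia.
subst b.
move=> /swap_ptsP [[b' [c' [bk' bc' ->]]]|[a' [b' [c' [abc' ak' ->]]]]]; rewrite height_vertex.
  by move=> /=; lia.
move=> hv; rewrite vertex_exchange.
(* The same exchange now gives the swapped triple {0, a', c}, as a' < k, and the unswapped triple
   {k, b', c'}. *)
exists (vertex a' ord0 c), (vertex k b' c'); rewrite !height_vertex /=; split=> //; try lia.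
- by apply/swap_ptsP; left; exists a', c; split=> //; lia.
- by apply/swap_ptsP; right; exists k, b', c'; split=> //=; lia.
Qed.

(** * The chain of mutations *)

Lemma partial_swap_step (R : realType) (m : nat) (k : 'I_m.+3) :
  (0 < k)%N -> (k < m.+2)%N ->
  mutation_step R (mf_polytope (partial_swap (n := m.+3) k))
                  (mf_polytope (partial_swap (n := m.+3) k.+1)).
Proof.
case: m k => [|m] k k0 km.
  (* For [n = 3] the only triple is {0, 1, 2}, and its vertex is translated by [shear_dir k]. *)
  have k1 : (k : nat) = 1%N by lia.
  left; have -> : mf_polytope (partial_swap (n := 3) k.+1) =
      mkLP [seq v + shear_dir k | v <- lp_pts (mf_polytope (partial_swap (n := 3) k))].
    rewrite /mf_polytope /= -map_comp; congr mkLP; apply/eq_in_map => -[[a b] c].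
    rewrite mem_filter => /andP[/andP[/= ab bc] _].
    have lec := ltn_ord c.
    have -> : a = ord0 by apply: ord_inj => /=; lia.
    have -> : b = k by apply: ord_inj; lia.
    by rewrite !vertex_partial_swap /= ltnn ltnSn vertex_shear.
  exact: translate_equiv.
(* Base vertex of height 0: the swapped triple {0, 1, n - 1} if [k > 1], the unswapped {0, 2, n - 1}
   if [k = 1], which requires [n >= 4]. *)
pose b : 'I_m.+4 := inord (if (k : nat) == 1%N then 2 else 1).
have bE : (b : nat) = if (k : nat) == 1%N then 2 else 1%N.
  by rewrite inordK //; case: ifP.
pose v0 := if (k : nat) == 1%N then vertex ord0 b ord_max else vertex b ord0 ord_max.
apply: (shears_step R (w := shear_dir k) (f := slope m.+4 k) (v0 := v0)).
- exact: shear_dir_primitive.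
- by rewrite /shear_dir heightD heightN !height_vertex /=; lia.
- apply/swap_ptsP; rewrite /v0; case: ifP bE => k1 bE; [right|left].
    by exists ord0, b, ord_max; split=> //=; lia.
  by exists b, ord_max; split=> //=; lia.
- by rewrite /v0; case: ifP bE => k1 bE; rewrite height_vertex /=; lia.
- exact: shears_up.
- exact: shears_down.
Qed.

Theorem theorem3p4 (R : realType) (n : nat) :
  (3 <= n)%N ->
  mutation_sequence R (mf_polytope (block_diag n 0)) (mf_polytope (block_diag n 1)).
Proof.
case: n => [|[|[|m]]] // _.
(* The fields run from index 1 to [n - 1 = m.+2], hence the shift by one and [m.+1] steps. *)
exists m.+1, (fun i => mf_polytope (partial_swap (n := m.+3) i.+1)).
split; [by rewrite block_diag0_swap | by rewrite block_diag1_swap |].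
move=> i im; have ik : (i.+1 < m.+3)%N by lia.
exact: (partial_swap_step R (k := Ordinal ik)).
Qed.
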